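(* Let $k,l\ge 1$ be fixed integers. Then $$p_{k,l}(2,n)=\frac{2^{k-1}n^{k+l-2}}{l!\,k!\,(k+l-2)!}+O(n^{k+l-3}).$$
   Context: For positive integers $n$, a partition of the $2\times n$ rectangle is a multiset of rectangular blocks with positive integer side lengths, where a block of size $a\times b$ is regarded as indistinguishable from a block of size $b\times a$ (blocks may be rotated by 90 degrees), such that the blocks of the multiset can be arranged so that they cover exactly the $2\times n$ rectangle with pairwise disjoint interiors. Two partitions are the same if they are equal as multisets (the arrangement does not matter). For positive integers $k,l$, $p_{k,l}(2,n)$ denotes the number of partitions of the $2\times n$ rectangle in which only blocks of sizes $1\times i$ with $1\le i\le k$ and $2\times j$ with $2\le j\le l$ are allowed; in particular $p_{k,1}(2,n)$ counts partitions using only blocks $1\times 1,\ldots,1\times k$. The $O$-term is for $n\to\infty$ with $k,l$ fixed (the implied constant may depend on $k,l$). *)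

(* Defs.v *)
From mathcomp Require Export all_boot all_order all_algebra.
From mathcomp Require Export finmap multiset.
From mathcomp Require Export all_classical all_reals all_analysis.
Export numFieldNormedType.Exports.

Set Implicit Arguments.
Unset Strict Implicit.
Unset Printing Implicit Defensive.

Import Order.TTheory GRing.Theory Num.Theory.
Local Open Scope classical_set_scope.
Local Open Scope ring_scope.

(* An unordered pair {a, b} of positive side lengths is stored as (a, b) with
   a <= b, so that a x b and b x a blocks are equal. *)
Definition is_block (b : nat * nat) : bool := (0 < b.1 <= b.2)%N.

(* The closed axis-parallel rectangle of dimensions [w] x [h] whose lower left
   corner is [z]. *)
Definition rectangle (R : realType) (z : R * R) (w h : nat) : set (R * R) :=
  [set u | (z.1 <= u.1 <= z.1 + w%:R) /\ (z.2 <= u.2 <= z.2 + h%:R)].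

(* The region covered by a block [b] put down with its corner at [z], after a
   rotation by 90 degrees if [rot]. *)
Definition placed (R : realType) (b : nat * nat) (z : R * R) (rot : bool) :
    set (R * R) :=
  if rot then rectangle z b.2 b.1 else rectangle z b.1 b.2.

Definition is_partition (R : realType) (m n : nat)
    (M : multiset (nat * nat)%type) : Prop :=
  (forall b, b \in M -> is_block b) /\
  exists (r : nat) (b : 'I_r -> (nat * nat)%type)
         (z : 'I_r -> R * R) (rot : 'I_r -> bool),
    [/\ M = seq_mset [seq b i | i : 'I_r],
        \bigcup_i placed (b i) (z i) (rot i) = rectangle (0, 0) m n
      & forall i j, i != j ->
          (placed (b i) (z i) (rot i))° `&` (placed (b j) (z j) (rot j))°
          = set0].

Definition allowed (k l : nat) (b : nat * nat) : bool :=
  ((b.1 == 1) && (1 <= b.2 <= k) || (b.1 == 2) && (2 <= b.2 <= l))%N.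

Definition partitions2 (R : realType) (k l n : nat) :
    set (multiset (nat * nat)%type) :=
  [set M | is_partition R 2 n M /\ forall b, b \in M -> allowed k l b].

(* [fset_set] is the empty set on infinite sets, but [partitions2 R k l n] is
   finite: comparing areas bounds the number of blocks by 2n. *)
Definition p2 (R : realType) (k l n : nat) : nat :=
  #|` fset_set (partitions2 R k l n)|%fset.

(* Main.v *)
Require Import Defs.
From mathcomp Require Import all_boot all_order all_algebra.
From mathcomp Require Import all_classical all_reals all_analysis.
From mathcomp Require Import zify ring lra.
Import numFieldNormedType.Exports.
Import Order.TTheory GRing.Theory Num.Theory.
Local Open Scope classical_set_scope.
Local Open Scope ring_scope.

Set Implicit Arguments.
Unset Strict Implicit.
Unset Printing Implicit Defensive.

(** Forgetting geometry, a partition of the [2 x n] rectangle is a multiset of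
    allowed blocks of total area [2n]; conversely such a multiset is a
    partition as soon as it contains at least [k] unit squares.  So the number
    of partitions lies between two values of one counting function: let [N(m)]
    be the number of multisets of allowed blocks of total area [m].

    - Areas add up, by Lebesgue measure: the pieces cover the rectangle and
      their interiors are disjoint ([partition_area]).  Hence
      [p2 R k l n <= N(2n)].
    - Stack all the [2 x j] blocks, then put each [1 x i] strip on top of the
      shorter of the two columns.  The heights never differ by more than [k],
      so [k] unit squares suffice to level them, and parity of the total area
      makes the final heights equal ([enough_squares_tile]).  Adding [k] unit
      squares to a multiset of area [2n - k] is injective and gives a partition
      once [n > 0] and [2n >= k], so [N(2n - k) <= p2 R k l n].

    [N] is the denumerant of the block areas, namely of [1], of [2, ..., k] and
    of [4, 6, ..., 2l].  With [d = k + l - 2] areas besides the unit square, of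
    product [k! 2^(l-1) l!] and sum [s], it satisfies
      [m^d <= d! k! 2^(l-1) l! N(m) <= (m + s)^d].
    Both bounds come from the recursion that either drops an area or uses it
    once more, combined with Bernoulli-type inequalities
    ([denumerant_lower], [denumerant_upper]).  The unit square makes the
    denumerant equal to [1] when [d = 0], which starts the induction.

    Altogether [d! k! 2^(l-1) l! p] and [(2n)^d] both lie in the window from
    [(2n - k)^d] to [(2n + s)^d], whose width is [O(n^(d-1))], and is [0] when
    [d = 0].  Dividing gives the main term [2^(k-1) n^d / (l! k! d!)]. *)

(** * Bernoulli-type inequalities *)

Section PowerBounds.
Local Open Scope nat_scope.

Lemma expn_add_ge (a w d : nat) :
  a ^ d.+1 + d.+1 * w * a ^ d <= (a + w) ^ d.+1.
Proof.
elim: d => [|d IHd]; first by rewrite !expn1 expn0 muln1 mul1n.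
rewrite [in leqRHS]expnS (leq_trans _ (leq_mul (leqnn _) IHd)) //.
rewrite !expnS; nia.
Qed.

Lemma expn_add_le (a w d : nat) :
  (a + w) ^ d.+1 <= a ^ d.+1 + d.+1 * w * (a + w) ^ d.
Proof.
elim: d => [|d IHd]; first by rewrite !expn1 expn0 muln1 mul1n.
rewrite [in leqLHS]expnS (leq_trans (leq_mul (leqnn _) IHd)) //.
have ad : a ^ d.+1 <= (a + w) ^ d.+1 by rewrite leq_exp2r // leq_addr.
have := leq_mul (leqnn w) ad; rewrite !expnS; nia.
Qed.

End PowerBounds.

(** * Counting multisets of given weight *)

Section Denumerant.
Variables (K : choiceType) (w : K -> nat).
Local Open Scope nat_scope.
Local Open Scope mset_scope.
Local Open Scope classical_set_scope.

Definition weight (M : {mset K}) := \sum_(b <- M) w b.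

Definition msets_of_weight (s : seq K) (N : nat) : set {mset K} :=
  [set M : {mset K} | (forall b, b \in M -> b \in s) /\ weight M = N].

Lemma weight_seq_mset s : weight (seq_mset s) = \sum_(b <- s) w b.
Proof. exact/perm_big/perm_eq_seq_mset. Qed.

Lemma weightD M1 M2 : weight (M1 `+` M2)%mset = weight M1 + weight M2.
Proof.
rewrite /weight -big_cat; apply: perm_big; apply/allP => b _ /=.
by rewrite count_cat !count_mem_mset msetE2.
Qed.

Lemma weight_msetn n b : weight (msetn n b) = n * w b.
Proof. by rewrite /weight enum_msetn big_nseq iter_addn_0 mulnC. Qed.

Lemma weight_in b M : b \in M -> w b <= weight M.
Proof. by move=> bM; rewrite -(msetB1K bM) weightD weight_msetn mul1n leq_addr. Qed.

Lemma msetD1_inj b : injective (msetD ([mset b] : {mset K})).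
Proof. exact: can_inj (msetDKB _). Qed.

Lemma msets_of_weight_lt b s N : N < w b ->
  msets_of_weight (b :: s) N = msets_of_weight s N.
Proof.
move=> Nb; apply/seteqP; split=> M [Ms MN]; split=> // c cM; last first.
  by rewrite inE Ms // orbT.
have := Ms c cM; rewrite inE => /predU1P[cb|//].
by have := weight_in cM; rewrite cb MN leqNgt Nb.
Qed.

(** Either [b] does not occur, or one copy of it can be removed: the recursion
    behind all the counting. *)
Lemma msets_of_weight_ge b s N : w b <= N ->
  msets_of_weight (b :: s) N =
  msets_of_weight s N `|` msetD ([mset b] : {mset K}) @` msets_of_weight (b :: s) (N - w b).
Proof.
move=> bN; apply/seteqP; split=> M.
- move=> [Ms MN]; have [bM|bM] := boolP (b \in M).
    right; exists (M `\ b)%mset; last exact: msetB1K.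
    split=> [c|]; first by rewrite in_msetB1 => /andP[_ /Ms].
    by have := weightD [mset b] (M `\ b)%mset; rewrite (msetB1K bM) MN weight_msetn; lia.
  left; split=> // c cM; have := Ms c cM; rewrite inE => /predU1P[cb|//].
  by rewrite -cb cM in bM.
- case=> [[Ms MN]|[M' [Ms MN] <-]]; split=> //.
  + by move=> c /Ms cs; rewrite inE cs orbT.
  + by move=> c; rewrite in_mset1D => /predU1P[->|/Ms //]; rewrite mem_head.
  + by rewrite weightD weight_msetn MN; lia.
Qed.

Lemma finite_msets_of_weight s N : all (fun b => 0 < w b) s ->
  finite_set (msets_of_weight s N).
Proof.
elim: s N => [N _|b s IHs N /= /andP[b0 s0]].
  apply: (@sub_finite_set _ _ [set (mset0 : {mset K})]) => [M [M0 _]|//].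
  by apply/msetP => c; rewrite mset0E; apply/mset_eq0P/negP => /M0.
have [m Nm] := ubnP N; elim: m N Nm => // m IHm N Nm.
have [Nb|bN] := ltnP N (w b); first by rewrite msets_of_weight_lt //; exact: IHs.
rewrite msets_of_weight_ge // finite_setU; split; first exact: IHs.
by apply: finite_image; apply: IHm; lia.
Qed.

Definition denumerant s N := #|` fset_set (msets_of_weight s N)|%fset.

Lemma denumerant_lt b s N : N < w b -> denumerant (b :: s) N = denumerant s N.
Proof. by rewrite /denumerant => /msets_of_weight_lt ->. Qed.

Lemma denumerant_ge b s N : b \notin s -> all (fun b => 0 < w b) (b :: s) ->
  w b <= N ->
  denumerant (b :: s) N = denumerant s N + denumerant (b :: s) (N - w b).
Proof.
move=> bs /[dup] bs0 /= /andP[b0 s0] bN.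
have fs := finite_msets_of_weight N s0.
have fbs := finite_msets_of_weight (N - w b) bs0.
rewrite /denumerant msets_of_weight_ge // fset_setU //; last exact: finite_image.
rewrite cardfsU fset_set_image // card_imfset /=; last exact: msetD1_inj.
rewrite (_ : _ `&` _ = fset0)%fset ?cardfs0 ?subn0 //.
apply/fsetP => M; rewrite in_fsetI inE; apply/negP => /andP[].
rewrite in_fset_set // inE => -[Ms _] /imfsetP[/= M' _ MM'].
by move: bs; rewrite (Ms b) // MM' mset1D1.
Qed.

Lemma denumerant1 b N : w b = 1 -> denumerant [:: b] N = 1.
Proof.
move=> b1; rewrite /denumerant (_ : msets_of_weight _ _ = [set (msetn N b : {mset K})]).
  by rewrite fset_set1 cardfs1.
apply/seteqP; split=> M /= => [[Mb MN]|->].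
  have ME : M = msetn (M b) b.
    apply/msetP => c; rewrite msetnE; case: eqVneq => [->//|cb].
    by apply/mset_eq0P/negP => /Mb; rewrite inE (negPf cb).
  by rewrite -MN {1}ME [in RHS]ME weight_msetn b1 muln1.
split=> [c|]; first by rewrite in_msetn inE => /andP[].
by rewrite weight_msetn b1 muln1.
Qed.

Variable b0 : K.
Hypothesis b01 : w b0 = 1.

(** By the recursion, the induction step amounts to
    [N^(d+1) <= (N - w b)^(d+1) + (d+1) (w b) N^d] for [w b <= N] and
    [d = size s]: the power grows by at most the length of the interval times
    the largest value of the derivative on it. *)
Lemma denumerant_lower s N : uniq (rcons s b0) -> all (fun b => 0 < w b) s ->
  N ^ size s <= (size s)`! * (\prod_(b <- s) w b) * denumerant (rcons s b0) N.
Proof.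
elim: s N => [N _ _|b s IHs N].
  by rewrite big_nil denumerant1.
rewrite rcons_cons [uniq _]/= => /andP[bs us] /andP[wb0 s0].
have bs0 : all (fun b => 0 < w b) (b :: rcons s b0).
  by rewrite /= all_rcons b01 /= wb0.
rewrite big_cons /= factS.
have [m Nm] := ubnP N; elim: m N Nm => // m IHm N Nm.
have IHs' := IHs N us s0.
set F := (size s)`! in IHm IHs' *; set P := \prod_(_ <- _) _ in IHm IHs' *.
have [Nb|bN] := ltnP N (w b).
  rewrite denumerant_lt // expnS.
  have Nw : N <= w b * (size s).+1 by nia.
  by have := leq_mul Nw IHs'; nia.
rewrite denumerant_ge //.
have := expn_add_le (N - w b) (w b) (size s); rewrite subnK // => pow.
apply: leq_trans pow _; rewrite mulnDr addnC leq_add ?IHm //; last lia.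
have -> : (size s).+1 * F * (w b * P) * denumerant (rcons s b0) N =
    (size s).+1 * w b * (F * P * denumerant (rcons s b0) N) by ring.
by rewrite leq_mul2l IHs' orbT.
Qed.

(** Dual to [denumerant_lower]: shifting [N] by the sum [t] of the weights in
    [s] leaves room for
    [(N + t)^(d+1) + (d+1) (w b) (N + t)^d <= (N + t + w b)^(d+1)]. *)
Lemma denumerant_upper s N : uniq (rcons s b0) -> all (fun b => 0 < w b) s ->
  (size s)`! * (\prod_(b <- s) w b) * denumerant (rcons s b0) N
    <= (N + \sum_(b <- s) w b) ^ size s.
Proof.
elim: s N => [N _ _|b s IHs N].
  by rewrite big_nil denumerant1.
rewrite rcons_cons [uniq _]/= => /andP[bs us] /andP[wb0 s0].
have bs0 : all (fun b => 0 < w b) (b :: rcons s b0).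
  by rewrite /= all_rcons b01 /= wb0.
rewrite !big_cons /= factS.
have [m Nm] := ubnP N; elim: m N Nm => // m IHm N Nm.
have IHs' := IHs N us s0.
set F := (size s)`! in IHm IHs' *; set P := \prod_(_ <- _) _ in IHm IHs' *.
set S := \sum_(_ <- _) _ in IHm IHs' *.
have step : (size s).+1 * F * (w b * P) * denumerant (rcons s b0) N <=
       (size s).+1 * w b * (N + S) ^ size s.
  have -> : (size s).+1 * F * (w b * P) * denumerant (rcons s b0) N =
    (size s).+1 * w b * (F * P * denumerant (rcons s b0) N) by ring.
  by rewrite leq_mul2l IHs' orbT.
rewrite addnCA addnC; apply: leq_trans (expn_add_ge (N + S) (w b) (size s)).
have [Nb|bN] := ltnP N (w b).
  by rewrite denumerant_lt // (leq_trans step) // leq_addl.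
rewrite denumerant_ge // mulnDr addnC leq_add //.
by have := IHm (N - w b) ltac:(lia); rewrite addnA subnK.
Qed.

End Denumerant.

(** * Areas of the pieces of a partition *)

Definition area (b : nat * nat) : nat := (b.1 * b.2)%N.

Lemma interiorX (T U : topologicalType) (A : set T) (B : set U) :
  (A `*` B)° = A° `*` B°.
Proof.
apply/seteqP; split=> [[x y] [[P Q] /= [xP yQ] PQ]|[x y] [/= xA yB]].
  have [Px Qy] := (nbhs_singleton xP, nbhs_singleton yQ).
  split; rewrite /= /interior.
    by apply: filterS xP => t Pt; have [] := PQ (t, y) (conj Pt Qy).
  by apply: filterS yQ => t Qt; have [] := PQ (x, t) (conj Px Qt).
by exists (A, B).
Qed.

Section Rectangles.
Context {R : realType}.
Implicit Types (z : R * R) (w h : nat) (b : nat * nat).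

Lemma rectangleE z w h :
  rectangle z w h = `[z.1, z.1 + w%:R] `*` `[z.2, z.2 + h%:R].
Proof. by apply/seteqP; split=> u; rewrite /= !in_itv. Qed.

Lemma interior_rectangle z w h :
  (rectangle z w h)° = `]z.1, z.1 + w%:R[ `*` `]z.2, z.2 + h%:R[.
Proof. by rewrite rectangleE interiorX !interior_itv_bnd. Qed.

Let mu := (@lebesgue_measure R \x @lebesgue_measure R)%E.

Lemma measurable_rectangle z w h : measurable (rectangle z w h).
Proof. by rewrite rectangleE; apply: measurableX; exact: measurable_itv. Qed.

Lemma measurable_interior_rectangle z w h : measurable (rectangle z w h)°.
Proof. by rewrite interior_rectangle; apply: measurableX; exact: measurable_itv. Qed.

Lemma lebesgue_measure_side (x : R) w (b1 b2 : bool) :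
  lebesgue_measure [set` Interval (BSide b1 x) (BSide b2 (x + w%:R))] = w%:R%:E.
Proof.
rewrite lebesgue_measure_itv /=; have [->|w0] := eqVneq w 0%N.
  by rewrite addr0 -EFinB subrr; case: ifP.
have xw : x < x + w%:R by rewrite ltrDl ltr0n lt0n.
by rewrite lte_fin xw -EFinB addrAC subrr add0r.
Qed.

Lemma measure_rectangle z w h : mu (rectangle z w h) = (w * h)%:R%:E.
Proof.
rewrite rectangleE [LHS]product_measure1E //.
by rewrite natrM EFinM; congr (_ * _)%E; exact: lebesgue_measure_side.
Qed.

Lemma measure_interior_rectangle z w h : mu (rectangle z w h)° = (w * h)%:R%:E.
Proof.
rewrite interior_rectangle [LHS]product_measure1E //.
by rewrite natrM EFinM; congr (_ * _)%E; exact: lebesgue_measure_side.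
Qed.

Lemma fsbig_setT (I : finType) (F : I -> \bar R) :
  (\sum_(i \in [set: I]) F i = \sum_i F i)%E.
Proof.
rewrite fsbig_finite //=; apply: perm_big; apply: uniq_perm.
- exact: fset_uniq.
- exact: index_enum_uniq.
- move=> i; rewrite [RHS]mem_index_enum in_fset_set ?in_setT //; exact: finite_finset.
Qed.

Lemma placedE b z rot :
  placed b z rot = rectangle z (if rot then b.2 else b.1) (if rot then b.1 else b.2).
Proof. by case: rot. Qed.

Lemma placed_area b (rot : bool) :
  ((if rot then b.2 else b.1) * (if rot then b.1 else b.2))%N = area b.
Proof. by case: rot => //; rewrite mulnC. Qed.

(** Closed and open rectangles have the same measure, so covering bounds the sum
    of the areas from below and disjointness of the interiors bounds it from
    above. *)
Lemma partition_area m n M : is_partition R m n M -> weight area M = (m * n)%N.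
Proof.
move=> [_ [r [b [z [rot [-> cover disj]]]]]].
rewrite weight_seq_mset big_image /=.
pose P i := placed (b i) (z i) (rot i).
have mP i : measurable (P i) by rewrite /P placedE; exact: measurable_rectangle.
have mP' i : measurable (P i)°.
  by rewrite /P placedE; exact: measurable_interior_rectangle.
have muP i : mu (P i) = (area (b i))%:R%:E.
  by rewrite /P placedE measure_rectangle placed_area.
have muP' i : mu (P i)° = (area (b i))%:R%:E.
  by rewrite /P placedE measure_interior_rectangle placed_area.
have sumE : (\sum_(i < r) (area (b i))%:R%:E)%E =
            (\sum_(i < r) area (b i))%:R%:E :> \bar R.
  by rewrite sumEFin natr_sum.
have Icover : \bigcup_i (P i)° `<=` rectangle (0, 0) m n.
  by rewrite -cover; apply: subset_bigcup => i _; exact: interior_subset.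
apply/eqP; rewrite -(eqr_nat R) eq_le -!lee_fin -sumE.
rewrite -(measure_rectangle (0, 0) m n); apply/andP; split.
- under eq_bigr do rewrite -muP'.
  have disj' : trivIset setT (fun i => (P i)°).
    move=> i j _ _ [u Pu]; apply/eqP/negPn/negP => /disj Pij.
    by move: Pu; rewrite Pij.
  rewrite -fsbig_setT -(measure_fin_bigcup mu (@finite_finset _ _) disj'); last first.
    by move=> i _; exact: mP'.
  apply: (le_measure mu) Icover; rewrite inE; last exact: measurable_rectangle.
  by apply: fin_bigcup_measurable => // i _; exact: mP'.
- under eq_bigr do rewrite -muP.
  rewrite -fsbig_setT; apply: (content_sub_fsum mu (@finite_finset _ _)).
  + by move=> i _; exact: mP.
  + exact: measurable_rectangle.
  + by rewrite cover.
Qed.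
End Rectangles.

(** * Tilings from multisets with many unit squares *)

Section Tilings.
Context {R : realType}.

(** Tilings built one piece at a time, which suits the greedy construction.  The
    new piece is asked to have its interior disjoint from the whole region
    tiled so far, a condition that needs no list of the earlier pieces. *)
Inductive tiling : seq (nat * nat) -> set (R * R) -> Prop :=
| tiling_nil : tiling [::] set0
| tiling_cons b z rot s A : tiling s A ->
    (placed b z rot)° `&` A = set0 -> tiling (b :: s) (placed b z rot `|` A).

Lemma tiling_positions d s A : tiling s A ->
  exists (z : nat -> R * R) (rot : nat -> bool),
    A = \bigcup_(i in `I_(size s)) placed (nth d s i) (z i) (rot i) /\
    forall i j, (i < j < size s)%N ->
      (placed (nth d s i) (z i) (rot i))° `&` (placed (nth d s j) (z j) (rot j))°
      = set0.
Proof.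
elim=> [|b z0 rot0 {}s {}A _ [z [rot [AE disj]]] bA].
  exists (fun=> (0, 0)), (fun=> false); split; last by move=> i j; rewrite ltn0 andbF.
  by apply/esym/bigcup0 => i /=; rewrite ltn0.
exists (fun i => if i is i'.+1 then z i' else z0).
exists (fun i => if i is i'.+1 then rot i' else rot0); split.
  apply/seteqP; split=> [u [ub|]|u [[|i] /= si ui]].
  - by exists 0%N.
  - by rewrite AE => -[i /= si ui]; exists i.+1.
  - by left.
  - by right; rewrite AE; exists i.
move=> [|i] [|j] //=; last by rewrite !ltnS => /disj.
move=> sj; apply/seteqP; split=> // u [ub /interior_subset uj].
by rewrite -bA; split=> //; rewrite AE; exists j.
Qed.

Lemma tiling_is_partition s m n : (forall b, b \in s -> is_block b) ->
  tiling s (rectangle (0, 0) m n) -> is_partition R m n (seq_mset s).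
Proof.
move=> blocks /(tiling_positions (0, 0)%N) [z [rot [cover disj]]]; split.
  by move=> b; rewrite (perm_mem (perm_eq_seq_mset s)) => /blocks.
exists (size s), (tnth (in_tuple s)), z, rot; split.
- by congr seq_mset; rewrite [RHS](map_tnth_enum (in_tuple s)).
- rewrite cover; apply/seteqP; split=> u [i /= si ui].
    by exists i => //=; rewrite -(tnth_nth _ (in_tuple s)).
  by exists (Ordinal si) => //; rewrite (tnth_nth (0, 0)%N).
- move=> i j; rewrite -val_eqE /= !(tnth_nth (0, 0)%N) /=.
  by rewrite neq_ltn => /orP[] ij; [|rewrite setIC]; apply: disj; rewrite ij ltn_ord.
Qed.

(** The union of two adjacent unit-wide columns of heights [m1] and [m2].  A column
    of height zero is empty here rather than a segment, so that the empty tiling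
    covers [columns 0 0]. *)
Definition columns (m1 m2 : nat) : set (R * R) :=
  [set u | ((0 < m1)%N /\ 0 <= u.1 <= 1 /\ 0 <= u.2 <= m1%:R) \/
           ((0 < m2)%N /\ 1 <= u.1 <= 2 /\ 0 <= u.2 <= m2%:R)].

Lemma columns0 : columns 0 0 = set0.
Proof. by apply/seteqP; split=> // u [[]|[]]. Qed.

Lemma columns_rectangle n : (0 < n)%N -> columns n n = rectangle (0, 0) 2 n.
Proof.
move=> n0; apply/seteqP; split=> [u|u]; rewrite /columns /rectangle /= n0.
  by case=> -[_ []] /andP[? ?] /andP[? ?]; split; lra.
case=> /andP[? ?] /andP[? ?]; case: (leP u.1 1) => ?; [left|right]; split=> //;
  split; lra.
Qed.

Lemma tiling_left s m1 m2 h : (0 < h)%N ->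
  tiling s (columns m1 m2) -> tiling ((1, h)%N :: s) (columns (m1 + h) m2).
Proof.
move=> h0 sm.
have h0R : (0 : R) < h%:R by rewrite ltr0n.
have m1R : (0 : R) <= m1%:R by rewrite ler0n.
have -> : columns (m1 + h) m2 = placed (1, h)%N (0, m1%:R) false `|` columns m1 m2.
  apply/seteqP; split=> u; rewrite /columns /placed /rectangle /= natrD.
    case=> [[_ [/andP[? ?] /andP[? ?]]]|?]; last by right; right.
    have [m10|m10] := posnP m1; last case: (leP u.2 m1%:R) => ?.
    - have m1E : m1%:R = 0 :> R by rewrite m10.
      by left; split; lra.
    - by right; left; split=> //; split; lra.
    - by left; split; lra.
  case=> [[/andP[? ?] /andP[? ?]]|[[? [/andP[? ?] /andP[? ?]]]|?]]; last by right.
  - by left; split; [lia|split; lra].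
  - by left; split; [lia|split; lra].
apply: tiling_cons => //; apply/seteqP; split=> // u [].
rewrite /placed interior_rectangle /columns /= !in_itv /=.
by case=> /andP[? ?] /andP[? ?] [[_ [/andP[? ?] /andP[? ?]]]|[_ [/andP[? ?] /andP[? ?]]]]; lra.
Qed.

Lemma tiling_right s m1 m2 h : (0 < h)%N ->
  tiling s (columns m1 m2) -> tiling ((1, h)%N :: s) (columns m1 (m2 + h)).
Proof.
move=> h0 sm.
have h0R : (0 : R) < h%:R by rewrite ltr0n.
have m2R : (0 : R) <= m2%:R by rewrite ler0n.
have -> : columns m1 (m2 + h) = placed (1, h)%N (1, m2%:R) false `|` columns m1 m2.
  apply/seteqP; split=> u; rewrite /columns /placed /rectangle /= natrD.
    case=> [?|[_ [/andP[? ?] /andP[? ?]]]]; first by right; left.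
    have [m20|m20] := posnP m2; last case: (leP u.2 m2%:R) => ?.
    - have m2E : m2%:R = 0 :> R by rewrite m20.
      by left; split; lra.
    - by right; right; split=> //; split; lra.
    - by left; split; lra.
  case=> [[/andP[? ?] /andP[? ?]]|[?|[? [/andP[? ?] /andP[? ?]]]]].
  - by right; split; [lia|split; lra].
  - by left.
  - by right; split; [lia|split; lra].
apply: tiling_cons => //; apply/seteqP; split=> // u [].
rewrite /placed interior_rectangle /columns /= !in_itv /=.
by case=> /andP[? ?] /andP[? ?] [[_ [/andP[? ?] /andP[? ?]]]|[_ [/andP[? ?] /andP[? ?]]]]; lra.
Qed.

Lemma tiling_slab s m h : (0 < h)%N ->
  tiling s (columns m m) -> tiling ((2, h)%N :: s) (columns (m + h) (m + h)).
Proof.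
move=> h0 sm.
have h0R : (0 : R) < h%:R by rewrite ltr0n.
have mR : (0 : R) <= m%:R by rewrite ler0n.
have -> : columns (m + h) (m + h) = placed (2, h)%N (0, m%:R) false `|` columns m m.
  rewrite columns_rectangle; last lia.
  have [->|m0] := posnP m; first by rewrite columns0 setU0.
  rewrite columns_rectangle //.
  apply/seteqP; split=> u; rewrite /placed /rectangle /= natrD.
    case=> /andP[? ?] /andP[? ?]; case: (leP u.2 m%:R) => ?; [right|left]; split; lra.
  by case=> -[/andP[? ?] /andP[? ?]]; split; lra.
apply: tiling_cons => //; apply/seteqP; split=> // u [].
rewrite /placed interior_rectangle /columns /= !in_itv /=.
by case=> /andP[? ?] /andP[? ?] [[_ [/andP[? ?] /andP[? ?]]]|[_ [/andP[? ?] /andP[? ?]]]]; lra.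
Qed.

(** The sum of the heights is recorded because its parity decides whether the two
    columns can end level. *)
Definition stacked s (m1 m2 : nat) :=
  tiling s (columns m1 m2) /\ (m1 + m2 = \sum_(b <- s) area b)%N.

Lemma stacked_slabs s : all (fun b => (b.1 == 2) && (0 < b.2))%N s ->
  exists m, stacked s m m.
Proof.
elim: s => [_|[a h] s IHs /= /andP[/andP[/= /eqP -> h0] /IHs [m [sm sumE]]]].
  by exists 0%N; rewrite /stacked columns0 big_nil; split=> //; exact: tiling_nil.
exists (m + h)%N; split; first exact: tiling_slab.
by rewrite big_cons -sumE /area /=; lia.
Qed.

(** A strip placed on the shorter column either overshoots, by at most [h], or
    brings the heights closer by [h]. *)
Lemma stacked_strip s m1 m2 h : (0 < h)%N -> stacked s m1 m2 ->
  exists m1' m2', stacked ((1, h)%N :: s) m1' m2' /\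
    (m1' - m2' + (m2' - m1') <= maxn h (m1 - m2 + (m2 - m1) - h))%N.
Proof.
move=> h0 [sm sumE]; rewrite /stacked big_cons -sumE /area /= mul1n.
case: (leqP m1 m2) => m12.
  by exists (m1 + h)%N, m2; split; [split; [exact: tiling_left|lia]|lia].
by exists m1, (m2 + h)%N; split; [split; [exact: tiling_right|lia]|lia].
Qed.

Lemma stacked_strips k s1 s2 m :
  all (fun b => (b.1 == 1) && (0 < b.2 <= k))%N s1 -> stacked s2 m m ->
  exists m1 m2, stacked (s1 ++ s2) m1 m2 /\ (m1 - m2 + (m2 - m1) <= k)%N.
Proof.
move=> + sm; elim: s1 => [_|[a h] s IHs /= /andP[/andP[/= /eqP -> /andP[h0 hk]] /IHs]].
  by exists m, m; split=> //; lia.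
move=> [m1 [m2 [sm12 dk]]]; have [m1' [m2' [t d]]] := stacked_strip h0 sm12.
by exists m1', m2'; split=> //; lia.
Qed.

Lemma stacked_squares a s m1 m2 : stacked s m1 m2 ->
  exists m1' m2', stacked (nseq a (1, 1)%N ++ s) m1' m2' /\
    (m1' - m2' + (m2' - m1') <= maxn 1 (m1 - m2 + (m2 - m1) - a))%N.
Proof.
move=> sm; elim: a => [|a [n1 [n2 [t d]]]]; first by exists m1, m2; split=> //; lia.
have [n1' [n2' [t' d']]] := stacked_strip (ltn0Sn 0) t.
by exists n1', n2'; split=> //; lia.
Qed.

(** After the slabs and strips the heights differ by at most [k]; the [a >= k]
    squares then bring the difference down to at most [1], and it is even since
    the total area is. *)
Lemma enough_squares_tile k n s1 s2 a :
  all (fun b => (b.1 == 1) && (0 < b.2 <= k))%N s1 ->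
  all (fun b => (b.1 == 2) && (0 < b.2))%N s2 ->
  let s := nseq a (1, 1)%N ++ s1 ++ s2 in
  (k <= a)%N -> (0 < n)%N -> (\sum_(b <- s) area b = 2 * n)%N ->
  tiling s (rectangle (0, 0) 2 n).
Proof.
move=> s1k s20 s ka n0 sE; have [m sm] := stacked_slabs s20.
have [m1 [m2 [sm12 dk]]] := stacked_strips s1k sm.
have [n1 [n2 [[t sumE] d]]] := stacked_squares a sm12.
rewrite -/s sE in sumE; have [n1E n2E] : n1 = n /\ n2 = n by lia.
by rewrite -columns_rectangle // -{1}n1E -n2E.
Qed.
End Tilings.

(** * Partitions against multisets of given area *)

Section Counting.
Variables (k l : nat).
Hypotheses (k1 : (1 <= k)%N) (l1 : (1 <= l)%N).
Local Open Scope mset_scope.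
Local Open Scope classical_set_scope.
Local Open Scope nat_scope.

Definition nonsquares : seq (nat * nat) :=
  [seq (1, i) | i <- iota 2 (k - 1)] ++ [seq (2, j) | j <- iota 2 (l - 1)].

Lemma allowedE b : allowed k l b = (b \in rcons nonsquares (1, 1)).
Proof.
rewrite mem_rcons inE mem_cat; apply/idP/idP.
  case: b => a i /orP[/andP[/= /eqP -> ki]|/andP[/= /eqP -> li]].
    have [->|i1] := eqVneq i 1; first by rewrite eqxx.
    by rewrite map_f ?orbT // mem_iota; lia.
  by rewrite (map_f (pair 2)) ?orbT // mem_iota; lia.
case/or3P => [/eqP ->|/mapP[i]|/mapP[j]]; first by rewrite /allowed /= k1.
  by rewrite mem_iota => i2 ->; rewrite /allowed /=; lia.
by rewrite mem_iota => j2 ->; rewrite /allowed /=; lia.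
Qed.

Lemma uniq_nonsquares : uniq (rcons nonsquares (1, 1)).
Proof.
rewrite rcons_uniq cat_uniq !map_inj_uniq ?iota_uniq /=; first last.
- by move=> i j [].
- by move=> i j [].
rewrite andbT mem_cat negb_or -andbA; apply/and3P; split.
- by apply/negP => /mapP[i]; rewrite mem_iota => + [i1]; rewrite -i1.
- by apply/negP => /mapP[i].
- by apply/negP => /hasP[b /mapP[i _ ->] /mapP[j]].
Qed.

Lemma size_nonsquares : size nonsquares = k + l - 2.
Proof. by rewrite size_cat !size_map !size_iota; lia. Qed.

Lemma area_nonsquares_gt0 : all (fun b => 0 < area b) nonsquares.
Proof.
apply/allP => b; rewrite mem_cat => /orP[] /mapP[i]; rewrite mem_iota => i2 ->;
by rewrite /area /=; lia.
Qed.

Lemma prod_iota2 n : 1 <= n -> \prod_(i <- iota 2 (n - 1)) i = n`!.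
Proof.
by case: n => // n _; rewrite fact_prod /index_iota !subSS subn0 big_cons mul1n.
Qed.

Lemma prod_area_nonsquares :
  \prod_(b <- nonsquares) area b = k`! * (2 ^ (l - 1) * l`!).
Proof.
rewrite big_cat !big_map /= /area /=; congr (_ * _).
  by under eq_bigr do rewrite mul1n; exact: prod_iota2.
by rewrite big_split /= big_const_seq count_predT size_iota iter_muln_1 prod_iota2.
Qed.

Context (R : realType).

Lemma partitions2_sub n :
  partitions2 R k l n `<=`
  msets_of_weight area (rcons nonsquares (1, 1)) (2 * n).
Proof.
move=> M [/partition_area areaM okM]; split=> // b /okM.
by rewrite allowedE.
Qed.

Lemma many_squares_partition n (M : {mset nat * nat}) :
  0 < n -> k <= M (1, 1) ->
  msets_of_weight area (rcons nonsquares (1, 1)) (2 * n) M ->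
  partitions2 R k l n M.
Proof.
move=> n0 kM [Mb areaM].
have okM b : b \in M -> allowed k l b by rewrite allowedE => /Mb.
split=> //.
pose sq := pred1 (1, 1) : pred (nat * nat).
pose s1 := [seq b <- [seq b <- M | predC sq b] | b.1 == 1].
pose s2 := [seq b <- [seq b <- M | predC sq b] | b.1 != 1].
pose s := nseq (M (1, 1)) (1, 1) ++ s1 ++ s2.
have sM : perm_eq s M.
  rewrite perm_sym -(perm_filterC sq) /s; apply: perm_cat.
    rewrite -count_mem_mset -size_filter.
    by rewrite (all_pred1P _ _ (filter_all (pred1 (1, 1)) M)) size_nseq.
  by rewrite perm_sym perm_filterC.
rewrite -(seq_mset_id M); move/eq_seq_msetP: (sM) => <-.
apply: tiling_is_partition.
  move=> b; rewrite (perm_mem sM) => /okM; rewrite /allowed /is_block.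
  lia.
apply: (@enough_squares_tile _ k) => //.
- apply/allP => b; rewrite !mem_filter => /and3P[/eqP b1 _ /okM].
  rewrite /allowed b1 /=; lia.
- apply/allP => b; rewrite !mem_filter => /and3P[b1 _ /okM].
  rewrite /allowed (negPf b1) /=; lia.
- by rewrite -areaM /weight; apply: perm_big.
Qed.

(** The image is taken under an injection, so this inclusion bounds the number of
    partitions from below. *)
Lemma add_squares_sub n : 0 < n -> k <= 2 * n ->
  msetD (msetn k (1, 1)) @`
    msets_of_weight area (rcons nonsquares (1, 1)) (2 * n - k)
  `<=` partitions2 R k l n.
Proof.
move=> n0 kn _ [M [Mb areaM] <-]; apply: many_squares_partition => //.
  by rewrite msetE2 msetnxx leq_addr.
split.
  move=> b; rewrite in_msetD => /orP[|/Mb //].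
  by rewrite in_msetn => /andP[_ /eqP ->]; rewrite mem_rcons mem_head.
by rewrite weightD weight_msetn areaM /area /=; lia.
Qed.

Let C := (k + l - 2)`! * (k`! * (2 ^ (l - 1) * l`!)).
Let S := \sum_(b <- nonsquares) area b.

Lemma finite_msets_of_area n :
  finite_set (msets_of_weight area (rcons nonsquares (1, 1)) n).
Proof.
by apply: finite_msets_of_weight; rewrite all_rcons area_nonsquares_gt0.
Qed.

Lemma finite_partitions2 n : finite_set (partitions2 R k l n).
Proof. exact: sub_finite_set (@partitions2_sub n) (finite_msets_of_area _). Qed.

Lemma p2_upper n : C * p2 R k l n <= (2 * n + S) ^ (k + l - 2).
Proof.
have b01 : area (1, 1) = 1 by [].
have := denumerant_upper b01 (2 * n) uniq_nonsquares area_nonsquares_gt0.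
rewrite size_nonsquares prod_area_nonsquares; apply: leq_trans.
rewrite leq_mul2l /p2 /denumerant.
have fP := finite_partitions2 n; have fM := finite_msets_of_area (2 * n).
by rewrite fsubset_leq_card ?orbT // -fset_set_sub //; exact: partitions2_sub.
Qed.

Lemma p2_lower n : 0 < n -> k <= 2 * n ->
  (2 * n - k) ^ (k + l - 2) <= C * p2 R k l n.
Proof.
move=> n0 kn; rewrite -size_nonsquares.
have b01 : area (1, 1) = 1 by [].
have := denumerant_lower b01 (2 * n - k) uniq_nonsquares area_nonsquares_gt0.
move/leq_trans; apply.
rewrite size_nonsquares prod_area_nonsquares leq_mul2l /p2 /denumerant.
have inj : injective (msetD (msetn k (1, 1) : {mset nat * nat})).
  exact: can_inj (msetDKB _).
have fP := finite_partitions2 n; have fM := finite_msets_of_area (2 * n - k).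
set A := msets_of_weight _ _ _ in fM *.
have <- : #|` fset_set (msetD (msetn k (1, 1)) @` A)|%fset = #|` fset_set A|%fset.
  by rewrite fset_set_image // card_imfset.
have fI := finite_image (msetD (msetn k (1, 1))) fM.
by rewrite fsubset_leq_card ?orbT // -fset_set_sub //; exact: add_squares_sub.
Qed.
End Counting.

(** * The error term *)

Section ErrorTerm.
Local Open Scope nat_scope.

Lemma window_width (d x k s : nat) : k <= x ->
  (x + s) ^ d.+1 - (x - k) ^ d.+1 <= d.+1 * (s + k) * (x + s) ^ d.
Proof.
move=> kx; have := expn_add_le (x - k) (s + k) d.
by rewrite addnCA subnK // (addnC s); lia.
Qed.

Lemma leq_exp2rW (a b e : nat) : a <= b -> a ^ e <= b ^ e.
Proof. by case: e => // e; rewrite leq_exp2r. Qed.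

(** Both [c p] and [x^d] lie in the same window; dividing by [c >= 1] does not
    increase their distance. *)
Lemma window_error (R : realFieldType) (d c x k s p : nat) : 0 < c ->
  (x - k) ^ d <= c * p <= (x + s) ^ d ->
  (`|p%:R - x%:R ^+ d / c%:R| <= ((x + s) ^ d - (x - k) ^ d)%:R :> R)%R.
Proof.
move=> c0 /andP[lo up].
have lox : (x - k) ^ d <= x ^ d by rewrite leq_exp2rW ?leq_subr.
have xup : x ^ d <= (x + s) ^ d by rewrite leq_exp2rW ?leq_addr.
move: lo up lox xup; set a := (x - k) ^ d; set u := (x + s) ^ d => lo up lox xup.
have cR : (0 < c%:R :> R)%R by rewrite ltr0n.
have c1 : (1 <= c%:R :> R)%R by rewrite ler1n.
set y := (_ - _)%R.
have cy : (c%:R * y = (c * p)%:R - (x ^ d)%:R)%R.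
  by rewrite /y natrM natrX mulrBr mulrCA divff ?mulr1 // gt_eqF.
have : (`|y| <= `|c%:R * y|)%R by rewrite normrM gtr0_norm // ler_peMl.
move/le_trans; apply; rewrite cy natrB ?(leq_trans lo) // ler_norml.
move: lo up lox xup; rewrite -!(ler_nat R); lra.
Qed.
End ErrorTerm.

Unset Implicit Arguments.

Theorem theorem1p7 (R : realType) (k l : nat) (hk : (1 <= k)%N)
    (hl : (1 <= l)%N) :
  (fun n : nat => (p2 R k l n)%:R : R^o) =
    (fun n : nat => 2 ^+ (k - 1) * n%:R ^+ (k + l - 2)
                    / (l`! * k`! * (k + l - 2)`!)%:R : R^o)
    +O_\oo (fun n : nat => n%:R ^ (k%:Z + l%:Z - 3) : R^o).
Proof.
set d := (k + l - 2)%N.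
pose c := (d`! * (k`! * (2 ^ (l - 1) * l`!)))%N.
pose s := (\sum_(b <- nonsquares k l) area b)%N.
have c0 : (0 < c)%N by rewrite !muln_gt0 !fact_gt0 expn_gt0.
have main n : 2 ^+ (k - 1) * n%:R ^+ d / (l`! * k`! * d`!)%:R =
    (2 * n)%:R ^+ d / c%:R :> R.
  have two0 : (2 : R) ^+ (l - 1) != 0 by rewrite expf_neq0 // pnatr_eq0.
  have fact0 m : m`!%:R != 0 :> R by rewrite pnatr_eq0 -lt0n fact_gt0.
  rewrite /c !natrM natrX exprMn (_ : d = (k - 1) + (l - 1))%N; last lia.
  rewrite [2 ^+ (_ + _)]exprD; field.
  by rewrite two0 !fact0.
apply/eqaddOP/bigO_exP.
(* For n >= 1 one has 2n + s <= (2 + s) n, whence the constant; the successor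
   keeps it positive when d = 0. *)
pose K := (d * (s + k) * (2 + s) ^ d.-1).+1.
exists K%:R; first by rewrite ltr0n.
near=> n.
have n0 : (0 < n)%N by near: n; exact: nbhs_infty_gt.
have kn : (k <= n)%N by near: n; exact: nbhs_infty_ge.
have kn2 : (k <= 2 * n)%N by lia.
rewrite [X in `|X|](_ : _ = (p2 R k l n)%:R - (2 * n)%:R ^+ d / c%:R); last first.
  by rewrite -main.
have win : ((2 * n - k) ^ d <= c * p2 R k l n <= (2 * n + s) ^ d)%N.
  by rewrite p2_lower // p2_upper.
apply: le_trans (window_error R c0 win) _.
have [d0|d0] := posnP d.
  by rewrite d0 !expn0 subnn mulr_ge0.
have -> : k%:Z + l%:Z - 3 = d.-1 by lia.
rewrite -exprnP normrX normr_nat -natrX -natrM ler_nat.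
rewrite -(prednK d0); apply: leq_trans (window_width _ _ kn2) _.
have np : ((2 * n + s) ^ d.-1 <= (2 + s) ^ d.-1 * n ^ d.-1)%N.
  by rewrite -expnMn leq_exp2rW // mulnDl leq_add2l leq_pmulr.
by rewrite prednK // (leq_trans (leq_mul (leqnn _) np)) // mulnA leq_mul.
Unshelve. all: by end_near.
Qed.
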